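(* Let $\alpha\in(0,1)$, let $\phi:[0,1]\to\mathbb{R}$ be a strictly increasing score-generating function, and let $\hat s=\mathcal{A}(\mathcal{D}^-_{n_-},\mathcal{D}^+_{n_+})$ be a scoring function produced by a bipartite ranking algorithm $\mathcal{A}$ from the first part of the data. For testing $\mathcal{H}_0: F=H\otimes G$, expressed as $\mathcal{H}_0: W^*_\phi=\int_0^1\phi(u)\,du$ versus $\mathcal{H}_1: W^*_\phi>\int_0^1\phi(u)\,du$, consider the test based on the second part of the data $\mathcal{D}'^-_{n'_-}\cup\mathcal{D}'^+_{n'_+}$ defined by $$\Phi^\phi_\alpha=\mathbb{I}\Big\{\frac1{n'_+}\widehat W^\phi_{n'_-,n'_+}(\hat s,\sigma')>\int_0^1\phi(u)\,du+q^\phi_{n'_-,n'_+}(\alpha)\Big\}.$$ Then, under $\mathcal{H}_0$, for any pair of distributions $(H\otimes G,F)$ and for all $1\le n'_-<n'$ and $1\le n'_+<n'$, $$\mathbb{P}_{\mathcal{H}_0}\{\Phi^\phi_\alpha(\mathcal{D}'_{n'}(\hat s))=+1\}\le\alpha,$$ where $\mathcal{D}'_{n'}(s)$ denotes the dataset obtained by mapping the observations of the second part of the data by the scoring function $s$.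
   Context: Data: $(\mathbf{X}_1,\mathbf{Y}_1),\ldots,(\mathbf{X}_N,\mathbf{Y}_N)$ are i.i.d. random pairs in $\mathcal{X}\times\mathcal{Y}$ with distribution $F$ having marginals $H$ and $G$. Let $n<N$ be an even integer and $n'=N-n$. Fix $p\in(0,1)$ and set $n_+=\lfloor pn\rfloor=n-n_-$ and $n'_+=\lfloor pn'\rfloor=n'-n'_-$. Let $\sigma,\sigma'$ be independent random permutations, independent of the data, uniformly distributed on the symmetric groups $\mathfrak{S}_{n_-}$ and $\mathfrak{S}_{n'_-}$ respectively. First part: $\mathcal{D}^-_{n_-}=\{(\mathbf{X}_i,\mathbf{Y}_{\sigma(i)}):1\le i\le n_-\}$ and $\mathcal{D}^+_{n_+}=\{(\mathbf{X}_i,\mathbf{Y}_i):1+n_-\le i\le n\}$. Second part: $\mathcal{D}'_{n'}=\{(\mathbf{X}_i,\mathbf{Y}_i):n+1\le i\le N\}$, from which one forms $\mathcal{D}'^-_{n'_-}=\{(\mathbf{X}_i,\mathbf{Y}_{n+\sigma'(i-n)}):1+n\le i\le n+n'_-\}$ and $\mathcal{D}'^+_{n'_+}=\{(\mathbf{X}_i,\mathbf{Y}_i):1+n+n'_-\le i\le N\}$. A scoring function is a map $s:\mathcal{X}\times\mathcal{Y}\to(-\infty,+\infty]$. A bipartite ranking algorithm $\mathcal{A}$ constructs a scoring function from a pair of (negative, positive) samples. Optimal performance: with $F_-=H\otimes G$, $F_+=F$, $F_{s,\epsilon}$ the cumulative distribution function of the pushforward of $F_\epsilon$ by $s$ for $\epsilon\in\{-,+\}$,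 and $F_s=pF_{s,+}+(1-p)F_{s,-}$, let $W_\phi(s)=\mathbb{E}[\phi(F_s(s(Z_+)))]$ with $Z_+$ of distribution $F_+$, and $W^*_\phi=W_\phi(\Psi)$ with $\Psi=dF/d(H\otimes G)$. Test statistic: $$\widehat W^\phi_{n'_-,n'_+}(\hat s,\sigma')=\sum_{i=1+n+n'_-}^N\phi\Big(\frac{R'_{\sigma'}(\hat s(\mathbf{X}_i,\mathbf{Y}_i))}{n'+1}\Big),$$ $$R'_{\sigma'}(t)=\sum_{i=1+n+n'_-}^N\mathbb{I}\{\hat s(\mathbf{X}_i,\mathbf{Y}_i)\le t\}+\sum_{i=1+n}^{n+n'_-}\mathbb{I}\{\hat s(\mathbf{X}_i,\mathbf{Y}_{n+\sigma'(i-n)})\le t\}.$$ Quantile: $\mathcal{L}^\phi_{n'_-,n'_+}$ is the distribution of the two-sample rank statistic $\sum_{i=1}^{n'_+}\phi(R_i/(n'+1))$ when the positive and negative scores have the same distribution, the ranks $(R_1,\ldots,R_{n'_+})$ of the positive scores in the pooled sample then being uniformly distributed (drawn without replacement from $\{1,\ldots,n'\}$). $q^\phi_{n'_-,n'_+}(\alpha)$ is the $(1-\alpha)$-quantile of the pushforward of $\mathcal{L}^\phi_{n'_-,n'_+}$ by the mapping $w\mapsto\frac1{n'_+}w-\int_0^1\phi(u)\,du$; it depends only on $\phi$, $n'_+$, $n'_-$ and $\alpha$.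
   Formalization: It is assumed that, almost surely, the law of ŝ under F has no atom (no ties): a constant ŝ makes the test reject with probability 1 when n'_+≥2. H_0 is taken as F=H⊗G; the expression W*_φ=∫φ is dropped, as W*_φ=φ(1) when Ψ=1. *)

(* Defs.v *)
From HB Require Import structures.
From mathcomp Require Import all_boot all_order all_fingroup all_algebra.
From mathcomp Require Import all_classical all_reals all_analysis.
From mathcomp Require Import measurable_realfun.

Set Implicit Arguments.
Unset Strict Implicit.
Unset Printing Implicit Defensive.

Import Order.TTheory GRing.Theory Num.Theory.

Local Open Scope classical_set_scope.
Local Open Scope ring_scope.

(* Permutations of a finite type carry the discrete sigma-algebra, so that a
   random permutation is a random variable. *)
HB.instance Definition _ (T : finType) :=
  isPointed.Build (perm_type T) (1%g : {perm T}).

Fact perm_display : measure_display. Proof. exact: default_measure_display. Qed.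

HB.instance Definition _ (T : finType) :=
  @isMeasurable.Build perm_display (perm_type T) discrete_measurable
    discrete_measurable0 discrete_measurableC discrete_measurableU.

Section probability.

Definition sigma_of d d' (T : measurableType d) (T' : measurableType d')
    (f : T -> T') : set (set T) :=
  preimage_set_system [set: T] f measurable.

Definition mutually_independent d (T : measurableType d) (R : realType)
    (P : probability T R) (I : finType) (C : I -> set (set T)) : Prop :=
  forall (J : {set I}) (B : I -> set T), (forall i, i \in J -> C i (B i)) ->
    P (\bigcap_(i in [set` J]) B i) = (\prod_(i in J) P (B i))%E.

Definition uniform_on (R : realType) (T : finType) (D : {set T}) (B : set T)
    : \bar R :=
  (#|[set x in D | x \in B]%SET|%:R / #|D|%:R)%:E.

Definition quantile (R : realType) (mu : set R -> \bar R) (u : R) : R :=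
  inf [set t | (u%:E <= mu `]-oo, t]%classic)%E].

End probability.

(* floor (p n) for p >= 0 *)
Definition nplus (R : realType) (p : R) (n : nat) : nat := Num.truncn (p * n%:R).

Definition nminus (R : realType) (p : R) (n : nat) : nat := (n - nplus p n)%N.

(* Observations are indexed from 0: the block of size m starting at offset o
   consists of z o, ..., z (o + m - 1). *)
Section samples.
Variables (TX TY : Type).
Implicit Types z : nat -> TX * TY.

Definition neg_sample z (o m : nat) (s : {perm 'I_m}) : m.-tuple (TX * TY) :=
  [tuple ((z (o + i)%N).1, (z (o + s i)%N).2) | i < m].

Definition pos_sample z (o m : nat) : m.-tuple (TX * TY) :=
  [tuple z (o + i)%N | i < m].

End samples.

Section ranking_algorithm.
Variables (R : realType) (d : measure_display) (T : measurableType d).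

Definition scoring_function (s : T -> \bar R) : Prop :=
  measurable_fun [set: T] s /\ forall z, s z != -oo%E.

(* Joint measurability makes the learnt score of an independent observation a
   random variable.  Samples are tuples, so A may depend on their order. *)
Definition bipartite_ranking_algorithm
    (A : forall m k, m.-tuple T -> k.-tuple T -> T -> \bar R) : Prop :=
  forall m k,
    (forall Dm Dp, scoring_function (A m k Dm Dp)) /\
    measurable_fun [set: m.-tuple T * k.-tuple T * T]
      (fun w => A m k w.1.1 w.1.2 w.2).

(* The law of the score has no atom, equivalently its distribution function is
   continuous: independent observations then have almost surely distinct
   scores. *)
Definition continuous_score (mu : set T -> \bar R) (s : T -> \bar R) : Prop :=
  forall t : \bar R, mu (s @^-1` [set t]) = 0%E.

End ranking_algorithm.

Section rank_test.
Variables (R : realType) (phi : R -> R).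

Definition mean_phi : R := \int[lebesgue_measure]_(u in `[0, 1]) phi u.

Section statistic.
Variables (m k : nat) (neg : m.-tuple (\bar R)) (pos : k.-tuple (\bar R)).

Definition pooled_rank (t : \bar R) : nat :=
  (\sum_(i < k) (tnth pos i <= t)%E + \sum_(i < m) (tnth neg i <= t)%E)%N.

Definition rank_statistic : R :=
  \sum_(i < k) phi ((pooled_rank (tnth pos i))%:R / (m + k).+1%:R).

End statistic.

(* r i : 'I_(m + k) encodes the rank (r i).+1 in {1, ..., m + k}. *)
Definition rank_sum m k (r : {ffun 'I_k -> 'I_(m + k)}) : R :=
  \sum_(i < k) phi ((r i).+1%:R / (m + k).+1%:R).

Definition null_rank_law (m k : nat) : set R -> \bar R :=
  fun B => uniform_on R [set r : {ffun 'I_k -> 'I_(m + k)} | injectiveb r]%SET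
             (@rank_sum m k @^-1` B).

Definition null_centered_law (m k : nat) : set R -> \bar R :=
  pushforward (null_rank_law m k) (fun w : R => k%:R^-1 * w - mean_phi).

Definition rank_quantile (m k : nat) (alpha : R) : R :=
  quantile (null_centered_law m k) (1 - alpha).

Definition rank_test (alpha : R) m k
    (neg : m.-tuple (\bar R)) (pos : k.-tuple (\bar R)) : nat :=
  nat_of_bool
    (mean_phi + rank_quantile m k alpha < k%:R^-1 * rank_statistic neg pos).

End rank_test.

Definition sources d d' (T : measurableType d) (T' : measurableType d')
    (N m m' : nat) (Z : nat -> T -> T')
    (sigma : T -> {perm 'I_m}) (sigma' : T -> {perm 'I_m'})
    (i : 'I_N + bool) : set (set T) :=
  match i with
  | inl j => sigma_of (Z j)
  | inr false => sigma_of sigma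
  | inr true => sigma_of sigma'
  end.

(* Main.v *)
(** Condition on the first part of the sample and on both permutations.  Under
    the null hypothesis F is a product law, so permuting the second components
    of i.i.d. observations leaves their joint law unchanged: the pooled second
    sample is i.i.d. with law F, independently of the learnt score.  Hence the
    rejection probability is the average, over all permutations of the pooled
    scores, of the probability of rejecting after permutation.  The scores are
    almost surely distinct, and then the ranks of the last k permuted scores run
    uniformly over the injections into the ranks, so that the proportion of
    rejecting permutations is the upper tail of the null law beyond its quantile,
    which is at most alpha. *)

Require Import Defs.
From HB Require Import structures.
From mathcomp Require Import all_boot all_order all_fingroup all_algebra.
From mathcomp Require Import all_classical all_reals all_analysis.
From mathcomp Require Import measurable_realfun lra.

Set Implicit Arguments.
Unset Strict Implicit.
Unset Printing Implicit Defensive.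

Import Order.TTheory GRing.Theory Num.Theory.

Local Open Scope classical_set_scope.
Local Open Scope ring_scope.

(** * Counting ranks *)

(** The range of [r] leaves exactly [m] free values; the first [m] indices are sent to these in the
    order of their enumeration. *)
Lemma perm_extends_injection m k (r : 'I_k -> 'I_(m + k)) : injective r ->
  exists s : {perm 'I_(m + k)}, forall i, s (rshift m i) = r i.
Proof.
move=> r_inj; pose C := (~: [set r i | i in 'I_k])%SET.
have cC : m = #|C|.
  by rewrite cardsCs finset.setCK card_imset// !card_ord addnK.
pose f j := match fintype.split j with
  | inl a => enum_val (cast_ord cC a)
  | inr i => r i end.
have f_inj : injective f.
  have CP a i : enum_val (cast_ord cC a) != r i.
    apply/eqP => E; have := enum_valP (cast_ord cC a).
    by rewrite E inE imset_f.
  move=> x y; rewrite /f; case: (fintype.splitP x) => a xa; case: (fintype.splitP y) => b yb E.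
  - by apply/val_inj; rewrite /= xa yb (cast_ord_inj (enum_val_inj E)).
  - by have := CP a b; rewrite E eqxx.
  - by have := CP b a; rewrite E eqxx.
  - by apply/val_inj; rewrite /= xa yb (r_inj _ _ E).
exists (perm f_inj) => i; rewrite permE /f.
by rewrite (_ : rshift m i = unsplit (inr i))// unsplitK.
Qed.

Section last_values.
Variables m k : nat.
Local Notation inj := [set r : {ffun 'I_k -> 'I_(m + k)} | injectiveb r]%SET.

(** The positive sample occupies the last [k] places of the pool, so only these values of a
    permutation determine its ranks. *)
Definition last_values (s : {perm 'I_(m + k)}) : {ffun 'I_k -> 'I_(m + k)} :=
  [ffun i => s (rshift m i)].

Lemma last_values_inj s : last_values s \in inj.
Proof. by rewrite inE; apply/injectiveP => i j; rewrite !ffunE => /perm_inj/rshift_inj. Qed.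

(** Right multiplication by a permutation [t] extending [r] maps the fiber over [last_values 1]
    bijectively onto the fiber over [r]. *)
Lemma card_last_values_fiber (r : {ffun 'I_k -> 'I_(m + k)}) : r \in inj ->
  #|[set s | last_values s == r]%SET| = #|[set s | last_values s == last_values 1]%SET|.
Proof.
rewrite inE => /injectiveP /perm_extends_injection[t tr].
rewrite -[RHS](card_imset _ (mulIg t)); apply: eq_card => s; apply/idP/imsetP => [|[u]].
  rewrite inE => /eqP sr; exists (s * t^-1)%g; last by rewrite mulgKV.
  by rewrite inE; apply/eqP/ffunP => i; move/ffunP/(_ i): sr;
    rewrite !ffunE permM perm1 -tr => ->; rewrite permK.
rewrite !inE => /eqP u1 ->; apply/eqP/ffunP => i.
by have := congr1 (fun f : {ffun 'I_k -> 'I_(m + k)} => f i) u1; rewrite !ffunE permM perm1 => ->.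
Qed.

(* Composition permutes the fibers of last_values transitively, so they all have
   the same cardinal, which is eliminated by counting with B true. *)
Lemma card_last_values (B : pred {ffun 'I_k -> 'I_(m + k)}) :
  (#|[set s | B (last_values s)]%SET| * #|inj| = #|[set r in inj | B r]%SET| * (m + k)`!)%N.
Proof.
set c := #|[set s | last_values s == last_values 1]%SET|.
have E (D : pred {ffun 'I_k -> 'I_(m + k)}) :
    #|[set s | D (last_values s)]%SET| = (#|[set r in inj | D r]%SET| * c)%N.
  rewrite -sum1_card (partition_big last_values (fun r => r \in [set r in inj | D r]%SET));
    last first.
    by move=> s Ds; apply/setIdP; split; [exact: last_values_inj|move: Ds; rewrite inE].
  rewrite -sum_nat_const; apply: eq_bigr => r /setIdP[ri Dr].
  rewrite /c -(card_last_values_fiber ri) -sum1_card; apply: eq_bigl => s.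
  by rewrite !inE; case: eqP => [->|]; rewrite ?Dr// andbF.
have := E xpredT.
rewrite (_ : [set s | _]%SET = [set: _]%SET); last by apply/setP => s; rewrite !inE.
rewrite (_ : [set r in _ | _]%SET = inj); last by apply/setP => s; rewrite !inE andbT.
rewrite cardsT card_Sn => ->.
by rewrite E mulnAC mulnA.
Qed.
End last_values.

(** The number of values at most [t] is a step function of [t] that jumps only at points [x i].
    Hence the infimum is a minimum, attained at the least [x i] whose count reaches [u]; the bounds
    on [u] make the set of levels bounded below and nonempty. *)
Lemma quantile_attained (R : realType) (I : finType) (x : I -> R) (D : {set I}) (u : R) :
  0 < u -> u <= #|D|%:R ->
  u <= #|[set i in D | x i <= inf [set t | u <= #|[set i in D | x i <= t]%SET|%:R]]%SET|%:R.
Proof.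
move=> u0 uD; set c := fun t => #|[set i in D | x i <= t]%SET|.
set Q := [set t | _].
(* Lowering a level [t] to the largest value not exceeding it loses no index. *)
have step t : u <= (c t)%:R -> exists i, [/\ i \in D, x i <= t & u <= (c (x i))%:R].
  move=> ut.
  have [i0 i0P] : exists i, i \in [set i in D | x i <= t]%SET.
    by apply/set0Pn; rewrite -card_gt0 -(ltr_nat R); exact: lt_le_trans ut.
  case: (Order.TotalTheory.arg_maxP x i0P) => i /setIdP[iD it] imax.
  exists i; split=> //; apply: (le_trans ut); rewrite ler_nat.
  apply/subset_leq_card/fintype.subsetP => j.
  by move=> /setIdP[jD jt]; apply/setIdP; split=> //; apply: imax; apply/setIdP.
have [i0 i0P] : exists i, (i \in D) && (u <= (c (x i))%:R).
  have [i iD] : exists i, i \in D.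
    by apply/set0Pn; rewrite -card_gt0 -(ltr_nat R); exact: lt_le_trans uD.
  case: (Order.TotalTheory.arg_maxP x iD) => j jD jmax.
  exists j; apply/andP; split; first exact: jD.
  apply: (le_trans uD); rewrite ler_nat.
  apply/subset_leq_card/fintype.subsetP => l lD.
  by apply/setIdP; split=> //; exact: jmax.
case: (@Order.TotalTheory.arg_minP _ _ _ i0
  (fun i => (i \in D) && (u <= (c (x i))%:R)) x i0P) => i /andP[iD ui] imin.
have -> // : inf Q = x i.
apply/eqP; rewrite eq_le; apply/andP; split.
  apply: ge_inf => //; exists (x i) => t /step[j [jD jt uj]].
  by apply: le_trans jt; apply: imin; rewrite jD.
apply: lb_le_inf; first by exists (x i).
by move=> t /step[j [jD jt uj]]; apply: le_trans jt; apply: imin; rewrite jD.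
Qed.

Section counting.
Variables (R : realType) (phi : R -> R) (m k : nat) (alpha : R).
Hypothesis alpha01 : 0 < alpha < 1.
Local Notation inj := [set r : {ffun 'I_k -> 'I_(m + k)} | injectiveb r]%SET.
Local Notation threshold := (mean_phi phi + rank_quantile phi m k alpha).

Lemma card_injections_gt0 : (0 < #|inj|)%N.
Proof. by apply/card_gt0P; exists (last_values 1); exact: last_values_inj. Qed.

(** At least a proportion [1 - alpha] of the injections have a centered statistic at or below the
    quantile, and the rejecting injections are the complement. *)
Lemma rank_quantile_tail :
  (#|[set r in inj | threshold < k%:R^-1 * rank_sum phi r]%SET|%:R
    <= alpha * #|inj|%:R).
Proof.
have [a0 a1] := andP alpha01.
have inj0 : 0 < #|inj|%:R :> R by rewrite ltr0n card_injections_gt0.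
pose x r := k%:R^-1 * @rank_sum _ phi m k r - mean_phi phi.
have lawE t : null_centered_law phi m k `]-oo, t] =
    (#|[set r in inj | x r <= t]%SET|%:R / #|inj|%:R)%:E.
  rewrite /null_centered_law /pushforward /null_rank_law /uniform_on.
  congr ((_%:R / _)%:E); apply: eq_card => r.
  apply/setIdP/setIdP => -[ri rB]; split=> //.
    by move/set_mem: rB => /=; rewrite in_itv.
  by apply/mem_set => /=; rewrite in_itv.
(* The law divides counts by [#|inj|], so the level [1 - alpha] becomes the count
   [(1 - alpha) * #|inj|]. *)
have := @quantile_attained R _ x inj ((1 - alpha) * #|inj|%:R).
have -> : inf [set t | (1 - alpha) * #|inj|%:R <= #|[set i in inj | x i <= t]%SET|%:R] =
    rank_quantile phi m k alpha.
  rewrite /rank_quantile /quantile; congr inf; apply/funext => t /=.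
  by rewrite lawE lee_fin ler_pdivlMr.
rewrite mulr_gt0 ?subr_gt0// => /(_ isT).
rewrite ler_piMl ?ler0n ?gerBl ?(ltW a0)// => /(_ isT).
set q := rank_quantile phi m k alpha => H.
have -> : #|[set r in inj | threshold < k%:R^-1 * rank_sum phi r]%SET|%:R =
    #|inj|%:R - #|[set r in inj | x r <= q]%SET|%:R :> R.
  rewrite -(cardsID [set r in inj | x r <= q]%SET inj).
  rewrite natrD (finset.setIidPr _); last by apply/fintype.subsetP => r /setIdP[].
  rewrite addrAC subrr add0r; congr _%:R; apply: eq_card => r.
  apply/setIdP/setDP => -[ri].
    by rewrite -ltrBrDl ltNge => xq; split=> //; apply/negP => /setIdP[_]; apply/negP.
  move=> rn; split=> //; rewrite -ltrBrDl ltNge; apply: contra rn => xq.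
  by apply/setIdP.
lra.
Qed.

Variable S : 'I_(m + k) -> \bar R.
Hypothesis S_inj : injective S.

(** This is the rank counted from 0, which matches the encoding of ranks by ordinals in
    [rank_sum]. *)
Let below j := #|[set l | (S l < S j)%E]%SET|.

Let below_lt j : (below j < m + k)%N.
Proof.
rewrite -[X in (_ < X)%N]card_ord -cardsT; apply: proper_card; apply/properP; split.
  exact: finset.subsetT.
by exists j; rewrite ?finset.in_setT// inE ltxx.
Qed.

Let rank j := Ordinal (below_lt j).

Let rank_inj : injective rank.
Proof.
have lt i j : (S i < S j)%E -> (below i < below j)%N.
  move=> ij; apply: proper_card; apply/properP; split.
    by apply/fintype.subsetP => l; rewrite !inE => /lt_trans; exact.
  by exists i; rewrite !inE ?ltxx.
move=> i j /(congr1 val)/= E; apply: S_inj; apply/eqP; rewrite eq_le !leNgt.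
by apply/andP; split; apply/negP => /lt; rewrite E ltnn.
Qed.

(** The two samples together exhaust the pool, so reindexing removes [s]. As the scores are
    distinct, those at most [S j] are the ones strictly below it and [S j] itself, whence the
    successor. *)
Lemma pooled_rankE (s : {perm 'I_(m + k)}) j :
  pooled_rank [tuple S (s (lshift k i)) | i < m] [tuple S (s (rshift m i)) | i < k] (S j)
  = (rank j).+1.
Proof.
transitivity (\sum_(l < m + k) (S (s l) <= S j)%E)%N.
  rewrite big_split_ord/= [RHS]addnC /pooled_rank.
  by congr addn; apply: eq_bigr => i _; rewrite tnth_mktuple.
transitivity (\sum_(l < m + k) (S l <= S j)%E)%N.
  by rewrite [RHS](reindex_inj (@perm_inj _ s)).
rewrite (bigD1 j)//= lexx add1n; congr _.+1.
rewrite /below -sum1_card big_mkcond/= [RHS]big_mkcond/=; apply: eq_bigr => l _.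
rewrite inE lt_neqAle; case: (eqVneq l j) => [->|lj]; first by rewrite eqxx.
by rewrite (inj_eq S_inj) lj/=; case: (_ <= _)%E.
Qed.

(** The test after permutation by [s] depends only on [last_values (s * rho)], where [rho] sends
    each index to its rank. Since multiplication by [rho] is a bijection, rejecting permutations are
    counted through the injections beyond the threshold. *)
Lemma card_rank_test :
  (#|[set s : {perm 'I_(m + k)} | rank_test phi alpha
       [tuple S (s (lshift k i)) | i < m] [tuple S (s (rshift m i)) | i < k] == 1%N]%SET|%:R
   <= alpha * (m + k)`!%:R).
Proof.
pose B (r : {ffun 'I_k -> 'I_(m + k)}) := threshold < k%:R^-1 * rank_sum phi r.
pose rho := perm rank_inj.
have -> : #|[set s : {perm 'I_(m + k)} | rank_test phi alpha
       [tuple S (s (lshift k i)) | i < m] [tuple S (s (rshift m i)) | i < k] == 1%N]%SET|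
    = #|[set s | B (last_values s)]%SET|.
  rewrite -[RHS](card_imset _ (mulIg (rho^-1)%g)); apply: eq_card => s.
  have E : rank_statistic phi [tuple S (s (lshift k i)) | i < m]
      [tuple S (s (rshift m i)) | i < k] = rank_sum phi (last_values (s * rho)%g).
    apply: eq_bigr => i _; rewrite tnth_mktuple pooled_rankE.
    by rewrite ffunE permM [rho _]permE.
  have -> : (s \in [set s : {perm 'I_(m + k)} | rank_test phi alpha
       [tuple S (s (lshift k i)) | i < m] [tuple S (s (rshift m i)) | i < k] == 1%N]%SET)
       = B (last_values (s * rho)%g).
    by rewrite inE /rank_test E /B; case: (_ < _).
  apply/idP/imsetP => [Bs|[u uB ->]].
    by exists (s * rho)%g; rewrite ?mulgK// inE.
  by move: uB; rewrite inE mulgKV.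
have inj0 : 0 < #|inj|%:R :> R by rewrite ltr0n card_injections_gt0.
rewrite -(ler_pM2r inj0) -natrM card_last_values natrM mulrAC.
by rewrite ler_wpM2r ?ler0n// rank_quantile_tail.
Qed.

End counting.

(** * Product laws on tuples *)

Section boxes.
Context {dX dY : measure_display} {TX : measurableType dX} {TY : measurableType dY}.
Variables (R : realType) (N : nat).
Implicit Types (A : 'I_N -> set TX) (B : 'I_N -> set TY).

(** The two components are constrained separately at each index, so that permuting first and second
    components by different permutations still carries boxes to boxes. *)
Definition box A B : set (N.-tuple (TX * TY)) :=
  [set z | forall i, A i (tnth z i).1 /\ B i (tnth z i).2].

Definition boxes : set_system (N.-tuple (TX * TY)) :=
  [set C | exists A B, [/\ forall i, measurable (A i), forall i, measurable (B i) & C = box A B]].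

Lemma measurable_box A B :
  (forall i, measurable (A i)) -> (forall i, measurable (B i)) -> measurable (box A B).
Proof.
move=> mA mB.
have -> : box A B = \bigcap_(i in [set: 'I_N]) ((fun z => tnth z i) @^-1` (A i `*` B i)).
  by apply/seteqP; split=> z zAB i => [_|]; have := zAB i; [|move=> /(_ Logic.I)].
apply: fin_bigcap_measurable; first exact: finite_finset.
move=> i _; rewrite -[X in measurable X]setTI; apply: measurable_tnth => //.
exact: measurableX.
Qed.

Lemma measurable_tuple_boxes : @measurable _ (N.-tuple (TX * TY)) = <<s boxes >>.
Proof.
apply/seteqP; split; last first.
  by apply: smallest_sub; [exact: sigma_algebra_measurable|
    move=> _ [A [B [mA mB ->]]]; exact: measurable_box].
(* It suffices that the identity be measurable from [M] to the tuples: a constraint on one component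
   of one coordinate is a box whose other sides are full. *)
pose M := g_sigma_algebraType boxes.
have mid : measurable_fun [set: M] (fun z : M => z : N.-tuple (TX * TY)).
  apply/measurable_fun_tnthP => i; apply/measurable_fun_pairP; split=> _ C mC.
    apply: (@sub_sigma_algebra _ setT boxes).
    exists (fun j => if j == i then C else setT), (fun=> setT); split=> //.
      by move=> j; case: ifP => _ //; exact: measurableT.
    apply/seteqP; split=> z /=.
      by move=> [_ Cz] j; split=> //; case: eqP => // ->.
    by move=> /(_ i); rewrite eqxx => -[].
  apply: (@sub_sigma_algebra _ setT boxes).
  exists (fun=> setT), (fun j => if j == i then C else setT); split=> //.
    by move=> j; case: ifP => _ //; exact: measurableT.
  apply/seteqP; split=> z /=.
    by move=> [_ Cz] j; split=> //; case: eqP => // ->.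
  by move=> /(_ i); rewrite eqxx => -[].
move=> E mE; rewrite -[E]setTI; exact: mid.
Qed.

(** Boxes form a generating pi-system containing the whole space, so they determine a finite
    measure. *)
Lemma eq_measure_boxes (m1 m2 : {measure set (N.-tuple (TX * TY)) -> \bar R}) :
  (m1 setT < +oo)%E ->
  (forall A B, (forall i, measurable (A i)) -> (forall i, measurable (B i)) ->
     m1 (box A B) = m2 (box A B)) ->
  forall E, measurable E -> m1 E = m2 E.
Proof.
move=> m1T m12 E mE; apply: (measure_unique boxes (fun=> setT)) => //.
- exact: measurable_tuple_boxes.
- move=> _ _ [A [B [mA mB ->]]] [A' [B' [mA' mB' ->]]].
  exists (fun i => A i `&` A' i), (fun i => B i `&` B' i); split.
  + by move=> i; exact: measurableI.
  + by move=> i; exact: measurableI.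
  + apply/seteqP; split=> z /=; first by move=> [zAB zAB'] i; have [] := zAB i; have [] := zAB' i.
    by move=> zz; split=> i; have [[? ?] [? ?]] := zz i.
- move=> _; exists (fun=> setT), (fun=> setT); split=> //.
  by apply/seteqP; split.
- by apply/seteqP; split=> // z _; exists 0%N.
- by move=> C [A [B [mA mB ->]]]; exact: m12.
Qed.
End boxes.

Lemma measurable_fun_mktuple d d' (T : measurableType d) (T' : measurableType d')
    n (f : 'I_n -> T -> T') : (forall i, measurable_fun [set: T] (f i)) ->
  measurable_fun [set: T] (fun x => [tuple f i x | i < n]).
Proof.
move=> mf; apply/measurable_fun_tnthP => i.
by rewrite (_ : _ \o _ = f i)//; apply/funext => x /=; rewrite tnth_mktuple.
Qed.

Section product_law.
Context {dX dY : measure_display} {TX : measurableType dX} {TY : measurableType dY}.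
Variables (R : realType) (N : nat).
Local Notation T := (TX * TY)%type.
Implicit Types (A : 'I_N -> set TX) (B : 'I_N -> set TY).

Lemma pushforward_eq_boxes d (U : measurableType d) (m : {measure set U -> \bar R})
    (f : U -> N.-tuple T) (m' : {measure set (N.-tuple T) -> \bar R}) :
  measurable_fun [set: U] f -> (m setT < +oo)%E ->
  (forall A B, (forall i, measurable (A i)) -> (forall i, measurable (B i)) ->
     m (f @^-1` box A B) = m' (box A B)) ->
  forall E, measurable E -> m (f @^-1` E) = m' E.
Proof.
move=> mf mT mm' E mE.
by apply: (@eq_measure_boxes _ _ _ _ _ _ (pushforward m f) m') => //.
Qed.

Variables (F : probability T R) (mu : probability (N.-tuple T) R).
Hypothesis mu_box : forall A B,
  (forall i, measurable (A i)) -> (forall i, measurable (B i)) ->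
  mu (box A B) = (\prod_i F (A i `*` B i))%E.

(** Since [F] factorizes, the measure of a box is a product of terms in [H] times a product of terms
    in [G], and each product can be reindexed on its own. *)
Lemma twist_invariant (H : probability TX R) (G : probability TY R)
    (f g : {perm 'I_N}) :
  (forall (A : set TX) (B : set TY), measurable A -> measurable B -> F (A `*` B) = (H A * G B)%E) ->
  forall E, measurable E ->
  mu ((fun z => [tuple ((tnth z (f i)).1, (tnth z (g i)).2) | i < N]) @^-1` E) = mu E.
Proof.
move=> FHG; apply: pushforward_eq_boxes.
- apply: measurable_fun_mktuple => i; apply: measurable_fun_pair.
    exact: measurableT_comp (measurable_tnth _).
  exact: measurableT_comp (measurable_tnth _).
- by rewrite /= probability_setT ltry.
- move=> A B mA mB.
  have -> : (fun z => [tuple ((tnth z (f i)).1, (tnth z (g i)).2) | i < N]) @^-1` box A B =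
      box (fun i => A ((f^-1)%g i)) (fun i => B ((g^-1)%g i)).
    apply/seteqP; split=> z zAB i /=.
      have := zAB ((f^-1)%g i); have := zAB ((g^-1)%g i).
      by rewrite !tnth_mktuple /= !permKV => -[_ +] [+ _].
    have := zAB (f i); have := zAB (g i).
    by rewrite !tnth_mktuple /= !permK => -[_ +] [+ _].
  rewrite /= !mu_box//.
  under eq_bigr do rewrite FHG//.
  under [RHS]eq_bigr do rewrite FHG//.
  rewrite !big_split/=; congr (_ * _)%E.
    rewrite (reindex_inj (@perm_inj _ f))/=.
    by apply: eq_bigr => i _; rewrite permK.
  rewrite (reindex_inj (@perm_inj _ g))/=.
  by apply: eq_bigr => i _; rewrite permK.
Qed.

Definition resample (j : 'I_N) (zb : N.-tuple T * T) : N.-tuple T :=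
  [tuple if i == j then zb.2 else tnth zb.1 i | i < N].

Lemma measurable_resample j : measurable_fun setT (resample j).
Proof.
apply: measurable_fun_mktuple => i; case: (i == j) ; first exact: measurable_snd.
exact: (@measurableT_comp _ _ _ _ _ _ (fun z : N.-tuple T => tnth z i) setT fst
  (measurable_tnth i) measurable_fst).
Qed.

(** Replacing one coordinate by an independent draw from [F] preserves the law of the tuple; the
    integral is the measure of the preimage under the product of [mu] and [F]. *)
Lemma resample_invariant j E : measurable E ->
  mu E = (\int[mu]_z F (xsection (resample j @^-1` E) z))%E.
Proof.
move=> mE; apply/esym; rewrite -[LHS]/((mu \x F)%E (resample j @^-1` E)).
apply: pushforward_eq_boxes mE; first exact: measurable_resample.
  by rewrite -setXTT [X in (X < _)%E]product_measure1E//= !probability_setT mule1 ltry.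
move=> A B mA mB.
(* The old coordinate [j] becomes free and its constraint passes to the new draw. *)
have -> : resample j @^-1` box A B =
    box (fun i => if i == j then setT else A i) (fun i => if i == j then setT else B i)
    `*` (A j `*` B j).
  apply/seteqP; split=> -[z b] /=.
    move=> zAB; split=> [i|].
      by have := zAB i; rewrite tnth_mktuple; case: eqP.
    by have := zAB j; rewrite tnth_mktuple eqxx.
  move=> [zAB bAB] i; rewrite tnth_mktuple; case: eqP => [->//|ij] /=.
  by have := zAB i; case: eqP.
rewrite /= product_measure1E//; first last.
- exact: measurableX.
- by apply: measurable_box => i; case: ifP => // _; exact: measurableT.
rewrite /= !mu_box//; first last.
- by move=> i; case: ifP => // _; exact: measurableT.
- by move=> i; case: ifP => // _; exact: measurableT.
rewrite (bigD1 j)//= [RHS](bigD1 j)//= eqxx setXTT probability_setT mul1e muleC.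
by congr (_ * _)%E; apply: eq_bigr => i /negPf ->.
Qed.

(** By Fubini, [E] is null once almost all its sections are. The hypothesis is applied to the
    measurable set of points with a non-null section, so that a possibly non-measurable condition on
    [z] can be exploited. *)
Lemma resample_null j E : measurable E ->
  (forall D, measurable D ->
     (forall z, D z -> F [set b | E (resample j (z, b))] <> 0%E) -> mu D = 0%E) ->
  mu E = 0%E.
Proof.
move=> mE H.
have mrE : measurable (resample j @^-1` E).
  by rewrite -[X in measurable X]setTI; exact: measurable_resample.
have xE z : xsection (resample j @^-1` E) z = [set b | E (resample j (z, b))].
  by apply/seteqP; split=> b; rewrite /xsection/= ?inE.
have mg := measurable_fun_xsection F mrE.
rewrite (resample_invariant j mE).
rewrite (ae_eq_integral (cst 0%E))//; first exact: integral0.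
exists [set z | (F \o xsection (resample j @^-1` E)) z != 0%E]; split.
- by rewrite -[X in measurable X]setTI; exact: measurable_neqe.
- apply: H; first by rewrite -[X in measurable X]setTI; exact: measurable_neqe.
  by move=> z /= /eqP; rewrite xE.
- by move=> z /= /not_implyP[_] /eqP.
Qed.

End product_law.

(** * Level of the test for a given score *)

Section block_perm.
Variables (n m : nat) (s : {perm 'I_n}) (t : {perm 'I_m}).

(** Block permutations serve to fix the first part of the data while permuting the second, or only
    its negative block. *)
Definition block_perm_fun (i : 'I_(n + m)) : 'I_(n + m) :=
  match fintype.split i with
  | inl a => lshift m (s a)
  | inr b => rshift n (t b)
  end.

Lemma block_perm_funl a : block_perm_fun (lshift m a) = lshift m (s a).
Proof. by rewrite /block_perm_fun (_ : lshift m a = unsplit (inl a))// unsplitK. Qed.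

Lemma block_perm_funr b : block_perm_fun (rshift n b) = rshift n (t b).
Proof. by rewrite /block_perm_fun (_ : rshift n b = unsplit (inr b))// unsplitK. Qed.

Lemma block_perm_fun_inj : injective block_perm_fun.
Proof.
move=> i j; case: (split_ordP i) => a ->; case: (split_ordP j) => b ->;
  rewrite ?block_perm_funl ?block_perm_funr => /eqP; rewrite ?eq_shift => //.
- by move=> /eqP/perm_inj ->.
- by move=> /eqP/perm_inj ->.
Qed.

Definition block_perm : {perm 'I_(n + m)} := perm block_perm_fun_inj.

Lemma block_perml a : block_perm (lshift m a) = lshift m (s a).
Proof. by rewrite permE block_perm_funl. Qed.

Lemma block_permr b : block_perm (rshift n b) = rshift n (t b).
Proof. by rewrite permE block_perm_funr. Qed.

End block_perm.

Lemma measurable_fun_sum_nat d (U : measurableType d) (I : Type) (r : seq I)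
    (f : I -> U -> nat) : (forall i, measurable_fun [set: U] (f i)) ->
  measurable_fun [set: U] (fun x => \sum_(i <- r) f i x)%N.
Proof.
move=> mf; elim: r => [|i r IH].
  by under eq_fun do rewrite big_nil; exact: measurable_cst.
by under eq_fun do rewrite big_cons; exact: measurable_fun_addn.
Qed.

Lemma measurable_rank_test d (U : measurableType d) (R : realType) (phi : R -> R)
    (alpha : R) m k (neg : 'I_m -> U -> \bar R) (pos : 'I_k -> U -> \bar R) :
  (forall i, measurable_fun [set: U] (neg i)) ->
  (forall i, measurable_fun [set: U] (pos i)) ->
  measurable [set x | rank_test phi alpha
    [tuple neg i x | i < m] [tuple pos i x | i < k] = 1%N].
Proof.
move=> mneg mpos.
have mle (f g : U -> \bar R) : measurable_fun setT f -> measurable_fun setT g ->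
    measurable_fun setT (fun x => nat_of_bool (f x <= g x)%E).
  move=> mf mg; apply: (@measurableT_comp _ _ _ _ _ _ nat_of_bool setT
    (fun x => (f x <= g x)%E)) => //.
  exact: measurable_fun_lee.
pose rk i x := pooled_rank [tuple neg i x | i < m] [tuple pos i x | i < k] (pos i x).
have mrk i : measurable_fun setT (rk i).
  apply: measurable_fun_addn; apply: measurable_fun_sum_nat => j;
    under eq_fun do rewrite tnth_mktuple; exact: mle.
have mstat : measurable_fun setT
    (fun x => rank_statistic phi [tuple neg i x | i < m] [tuple pos i x | i < k]).
  apply: measurable_sum => i; under eq_fun do rewrite [tnth [tuple pos _ _ | _ < _] _]tnth_mktuple.
  (* every function on the discrete space of the ranks is measurable *)
  exact: (@measurableT_comp _ _ _ _ _ _ (fun r : nat => phi (r%:R / (m + k).+1%:R)) setT (rk i)).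
rewrite (_ : [set x | _] = [set x | mean_phi phi + rank_quantile phi m k alpha <
   k%:R^-1 * rank_statistic phi [tuple neg i x | i < m] [tuple pos i x | i < k]]).
  rewrite -[X in measurable X]setTI.
  apply: (measurable_fun_ltr (f := cst (mean_phi phi + rank_quantile phi m k alpha)) _ _ measurableT
    (Y := [set true])) => //.
  exact: measurable_funM.
by apply/seteqP; split=> x /=; rewrite /rank_test; case: (_ < _).
Qed.

Section level.
Context {dX dY : measure_display} {TX : measurableType dX} {TY : measurableType dY}.
Variables (R : realType) (n m k : nat).
Local Notation T := (TX * TY)%type.
Local Notation N := (n + (m + k))%N.
Variables (F : probability T R) (H : probability TX R) (G : probability TY R).
Variable mu : probability (N.-tuple T) R.
Variables (phi : R -> R) (alpha : R) (sc : N.-tuple T -> T -> \bar R).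

Hypothesis mu_box : forall A B,
  (forall i, measurable (A i)) -> (forall i, measurable (B i)) ->
  mu (box A B) = (\prod_i F (A i `*` B i))%E.
Hypothesis FHG : forall (A : set TX) (B : set TY),
  measurable A -> measurable B -> F (A `*` B) = (H A * G B)%E.
Hypothesis alpha01 : 0 < alpha < 1.
Hypothesis msc : measurable_fun [set: N.-tuple T * T] (fun zb => sc zb.1 zb.2).
(** The score is learnt from the first [n] observations, so redrawing or permuting the later ones
    leaves it unchanged. *)
Hypothesis sc_dep : forall z z',
  (forall i : 'I_n, tnth z (lshift (m + k) i) = tnth z' (lshift (m + k) i)) ->
  sc z = sc z'.
(* The set of the z whose score has an atom need not be measurable, hence the
   quantification over its measurable subsets. *)
Hypothesis sc_cont : forall D, measurable D ->
  (forall z, D z -> ~ continuous_score F (sc z)) -> mu D = 0%E.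

Let S z (j : 'I_(m + k)) := sc z (tnth z (rshift n j)).

Let mS j : measurable_fun setT (S ^~ j).
Proof.
apply: (@measurableT_comp _ _ _ _ _ _ _ setT (fun z => (z, tnth z (rshift n j))) msc).
apply: measurable_fun_pair => //; exact: measurable_tnth.
Qed.

(* Redraw the j-th pooled observation: given the others, its score avoids the
   value of the i-th one. *)
Lemma ties_null i j : i != j -> mu [set z | S z i = S z j] = 0%E.
Proof.
move=> ij; apply: (resample_null mu_box (j := rshift n j)).
  by have := measurable_eqe measurableT (mS i) (mS j); rewrite setTI.
move=> D mD DF; apply: sc_cont => // z Dz cz; apply: (DF z Dz).
rewrite -[RHS](cz (S z i)); congr (F _); apply/seteqP; split=> b /=;
  rewrite /S !tnth_mktuple eq_rshift (negPf ij) eqxx/= (_ : sc (resample _ _) = sc z)//;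
  by apply: sc_dep => l; rewrite tnth_mktuple eq_lrshift.
Qed.

Definition score_test z (s : {perm 'I_(m + k)}) := rank_test phi alpha
  [tuple S z (s (lshift k i)) | i < m] [tuple S z (s (rshift m i)) | i < k].

Let test s := [set z | score_test z s = 1%N].

Lemma measurable_score_test s : measurable (test s).
Proof. by apply: measurable_rank_test => i; exact: mS. Qed.

(** Permuting whole pairs within the second part changes neither the law of the sample nor the
    learnt score. *)
Lemma score_test_perm s : mu (test s) = mu (test 1%g).
Proof.
rewrite -(twist_invariant mu_box (block_perm 1%g s) (block_perm 1%g s) FHG
  (measurable_score_test 1%g)).
congr (mu _); apply/funext => z; rewrite /test/=.
set z' := [tuple _ | _ < _]; have SE j : S z' j = S z (s j).
  rewrite /S tnth_mktuple !block_permr -surjective_pairing (_ : sc z' = sc z)//.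
  by apply: sc_dep => i; rewrite tnth_mktuple !block_perml perm1 -surjective_pairing.
by congr (rank_test _ _ _ _ = 1%N); apply: eq_from_tnth => i; rewrite !tnth_mktuple perm1 SE.
Qed.

(** All permuted tests reject with the same probability, so [(m + k)!] times it is the expected
    number of rejecting permutations. Without ties that number is at most [alpha * (m + k)!]. *)
Lemma score_test_level : (mu (test 1%g) <= alpha%:E)%E.
Proof.
pose c : R := (m + k)`!%:R; have c0 : 0 < c by rewrite ltr0n fact_gt0.
have int1 : (c%:E * mu (test 1%g) = \int[mu]_z (\sum_s \1_(test s) z)%:E)%E.
  under eq_integral do rewrite -sumEFin.
  rewrite ge0_integral_sum//; last first.
    by move=> s; apply/measurable_EFinP; apply: measurable_indic; exact: measurable_score_test.
  under eq_bigr do rewrite (integral_indic _ _ (measurable_score_test _))// setIT/= score_test_perm.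
  rewrite sumr_const mule_natl; congr (_ *+ _)%E.
  by rewrite -card_Sn; apply: eq_card.
rewrite -(@lee_pmul2l _ c%:E)// int1 -EFinM.
have -> : (c * alpha)%:E = (\int[mu]_z (cst (c * alpha)%:E z))%E.
  by rewrite integral_cst//= probability_setT mule1.
apply: ae_ge0_le_integral => //.
- by move=> z _; rewrite lee_fin; apply: sumr_ge0.
- by apply/measurable_EFinP; apply: measurable_sum => s; apply: measurable_indic; exact: measurable_score_test.
- by move=> z _; rewrite lee_fin mulr_ge0// ltW//; case/andP: alpha01.
(* There are finitely many pairs of indices, and each has a null tie event. *)
have : {ae mu, forall z ij, S z ij.1 = S z ij.2 -> ij.1 = ij.2}.
  apply: filter_forall => -[i j] /=; have [->|ij] := eqVneq i j.
    exact: aeW.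
  exists [set z | S z i = S z j]; split; last 2 first.
  - exact: ties_null.
  - by move=> z /= /not_implyP[].
  by have := measurable_eqe measurableT (mS i) (mS j); rewrite setTI.
apply: filterS => z noties _.
have S_inj : injective (S z) by move=> i j; exact: (noties (i, j)).
rewrite lee_fin mulrC; apply: le_trans (card_rank_test phi alpha01 S_inj).
rewrite -sum1_card natr_sum [leRHS]big_mkcond/=; apply: ler_sum => s _.
rewrite indicE (_ : (z \in test s) = (score_test z s == 1%N)); last first.
  by apply/idP/eqP => [/set_mem|sz]; [|exact/mem_set].
by rewrite inE -/(score_test z s); case: (_ == _).
Qed.

End level.

(** * Sample splitting *)

Lemma measure_bigsetU_le d (U : measurableType d) (R : realType)
    (P : {measure set U -> \bar R}) (I : finType) (C : I -> set U) :
  (forall i, measurable (C i)) ->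
  (P (\bigcup_(i in [set: I]) C i) <= \sum_i P (C i))%E.
Proof.
move=> mC; rewrite (_ : [set: I] = [set` index_enum I]); last first.
  by apply/seteqP; split=> i //= _; rewrite mem_index_enum.
rewrite bigcup_seq.
(* Measurability is carried along with the bound, as subadditivity requires it at each step. *)
pose K (X : set U) (x : \bar R) := measurable X /\ (P X <= x)%E.
suff [] : K (\big[setU/set0]_i C i) (\sum_i P (C i))%E by [].
apply: (big_ind2 K) => //; first by split; rewrite ?measure0.
move=> X x Y y [mX Xx] [mY Yy]; split; first exact: measurableU.
by apply: le_trans (measureU2 P mX mY) _; exact: leeD.
Qed.

Lemma uniform_on1 (R : realType) (I : finType) (x : I) :
  uniform_on R [set: I]%SET [set x] = (#|I|%:R^-1)%:E.
Proof.
rewrite /uniform_on cardsT (_ : [set y in _ | _]%SET = [set x]%SET) ?cards1 ?mul1r//.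
apply/setP => y; rewrite !inE; apply/idP/eqP => [|->]; first by rewrite inE.
by rewrite inE.
Qed.

Lemma measurable_nth_tuple d (U : measurableType d) n i :
  measurable_fun [set: n.-tuple U] (fun z : n.-tuple U => nth point z i).
Proof.
have [ni|ni] := leqP n i.
  rewrite (_ : (fun _ => _) = cst point); first exact: measurable_cst.
  by apply/funext => z /=; rewrite nth_default ?size_tuple.
rewrite (_ : (fun _ => _) = (fun z => tnth z (Ordinal ni))); first exact: measurable_tnth.
by apply/funext => z; rewrite (tnth_nth point).
Qed.

Lemma nplus_le (R : realType) (p : R) n : 0 < p < 1 -> (nplus p n <= n)%N.
Proof.
move=> /andP[p0 p1]; rewrite -(ler_nat R); apply: (@le_trans _ _ (p * n%:R)).
  by rewrite truncn_le// mulr_ge0// ltW.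
by rewrite ler_piMl ?ler0n// ltW.
Qed.

Section independence.
Context {d dX dY dS dS' : measure_display} {Omega : measurableType d}
  {TX : measurableType dX} {TY : measurableType dY}
  {TS : measurableType dS} {TS' : measurableType dS'}.
Variables (R : realType) (N : nat) (P : probability Omega R).
Local Notation T := (TX * TY)%type.
Variables (F : probability T R) (V : {RV P >-> N.-tuple T}).

(** As functions of [E], both sides are finite measures: the image by [V] of [P] restricted to [C],
    and the law of [V] scaled by [P C]. They agree on boxes. *)
Lemma independent_of_boxes C :
  measurable C ->
  (forall A B, (forall i, measurable (A i)) -> (forall i, measurable (B i)) ->
     P (V @^-1` box A B `&` C) = (P (V @^-1` box A B) * P C)%E) ->
  forall E, measurable E -> P (V @^-1` E `&` C) = (P (V @^-1` E) * P C)%E.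
Proof.
move=> mC PC E mE.
have PCfin : P C \is a fin_num by exact: fin_num_measure.
pose c := NngNum (fine_ge0 (measure_ge0 P C)).
transitivity (mscale c (distribution P V) E); last first.
  by rewrite /mscale/= fineK// muleC.
apply: (@pushforward_eq_boxes _ _ _ _ _ _ _ _ (mrestr P mC) V (mscale c (distribution P V))) mE.
- exact: measurable_funPT.
- by rewrite /= /mrestr setTI ltey_eq PCfin.
- by move=> A B mA mB; rewrite /= /mrestr PC// /mscale/= fineK// muleC.
Qed.
End independence.

Section split_sample.
Context {d dX dY : measure_display} {Omega : measurableType d}
  {TX : measurableType dX} {TY : measurableType dY}.
Local Notation T := (TX * TY)%type.
Variables (R : realType) (P : probability Omega R) (F : probability T R)
  (H : probability TX R) (G : probability TY R).
Variables (nm np m k : nat).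
Local Notation n := (nm + np)%N.
Local Notation N := (n + (m + k))%N.
Variables (Z : nat -> {RV P >-> T})
  (sigma : {RV P >-> {perm 'I_nm}}) (sigma' : {RV P >-> {perm 'I_m}})
  (alg : nm.-tuple T -> np.-tuple T -> T -> \bar R) (phi : R -> R) (alpha : R).

Hypothesis FHG : forall (C : set TX) (D : set TY),
  measurable C -> measurable D -> F (C `*` D) = (H C * G D)%E.
Hypothesis ZF : forall i, (i < N)%N ->
  forall B, measurable B -> distribution P (Z i) B = F B.
Hypothesis sigmaU : forall B, distribution P sigma B = uniform_on R [set: {perm 'I_nm}]%SET B.
Hypothesis sigmaU' : forall B, distribution P sigma' B = uniform_on R [set: {perm 'I_m}]%SET B.
Hypothesis indep : mutually_independent P (@sources _ _ _ _ N _ _ Z sigma sigma').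
Hypothesis malg : measurable_fun [set: nm.-tuple T * np.-tuple T * T]
  (fun w => alg w.1.1 w.1.2 w.2).
Hypothesis alpha01 : 0 < alpha < 1.

Let sample_fun w : N.-tuple T := [tuple Z i w | i < N].

Let msample : measurable_fun setT sample_fun.
Proof. exact: measurable_fun_mktuple. Qed.

HB.instance Definition _ := isMeasurableFun.Build _ _ _ _ sample_fun msample.

Let sample : {RV P >-> N.-tuple T} := sample_fun.

Let mu : probability (N.-tuple T) R := distribution P sample.

(** This is mutual independence over the full index set. Permutations carry the discrete
    sigma-algebra, so [D] and [D'] are arbitrary. *)
Lemma sources_law A B D D' :
  (forall i, measurable (A i)) -> (forall i, measurable (B i)) ->
  P (sample @^-1` box A B `&` (sigma @^-1` D `&` sigma' @^-1` D')) =
  ((\prod_i F (A i `*` B i)) * (P (sigma @^-1` D) * P (sigma' @^-1` D')))%E.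
Proof.
move=> mA mB.
pose E (i : 'I_N + bool) := match i with
  | inl j => Z j @^-1` (A j `*` B j)
  | inr false => sigma @^-1` D
  | inr true => sigma' @^-1` D' end.
have := indep (J := [set: _]%SET) (B := E).
have -> : \bigcap_(i in [set` [set: 'I_N + bool]%SET]) E i =
    sample @^-1` box A B `&` (sigma @^-1` D `&` sigma' @^-1` D').
  apply/seteqP; split=> w /=.
    move=> EE; split.
      by move=> i; rewrite tnth_mktuple; apply: (EE (inl i)); rewrite /= inE.
    by split; [apply: (EE (inr false))|apply: (EE (inr true))]; rewrite /= inE.
  move=> [zAB [sD sD']] [i|[]] _ //=.
  by have := zAB i; rewrite tnth_mktuple.
move=> ->; last first.
  move=> [i|[]] _ /=; [exists (A i `*` B i)|exists D'|exists D]; rewrite ?setTI//.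
  exact: measurableX.
under eq_bigl do rewrite inE.
rewrite big_sumType/=; congr (_ * _)%E; last by rewrite big_bool/= muleC.
by apply: eq_bigr => i _; rewrite -(ZF (ltn_ord i))//; exact: measurableX.
Qed.

Lemma sample_box A B :
  (forall i, measurable (A i)) -> (forall i, measurable (B i)) ->
  mu (box A B) = (\prod_i F (A i `*` B i))%E.
Proof.
move=> mA mB; have := @sources_law A B setT setT mA mB.
by rewrite !preimage_setT !setIT probability_setT !mule1.
Qed.

Lemma sample_indep E D D' : measurable E ->
  P (sample @^-1` E `&` (sigma @^-1` D `&` sigma' @^-1` D')) =
  (mu E * (P (sigma @^-1` D) * P (sigma' @^-1` D')))%E.
Proof.
(* Taking all sides of the box full gives the independence of the two permutations. *)
have sDD' : P (sigma @^-1` D `&` sigma' @^-1` D') = (P (sigma @^-1` D) * P (sigma' @^-1` D'))%E.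
  have := @sources_law (fun=> setT) (fun=> setT) D D' (fun=> measurableT) (fun=> measurableT).
  rewrite (_ : box _ _ = setT); last by apply/seteqP; split.
  rewrite preimage_setT setTI => ->.
  by rewrite big1 ?mul1e// => i _; rewrite setXTT probability_setT.
move=> mE; rewrite -sDD' -[mu E]/(P (sample @^-1` E)).
apply: independent_of_boxes mE.
  by apply: measurableI; exact: measurable_funPTI.
move=> A B mA mB; rewrite sources_law// sDD'; congr (_ * _)%E.
by rewrite -sample_box.
Qed.

(** The learnt score with the first permutation frozen at [s], as a function of the sample alone;
    [score_learnt] recovers the actual score at [s = sigma w]. *)
Let score s (z : N.-tuple T) :=
  alg (neg_sample (nth point z) 0 s) (pos_sample (nth point z) nm np).

Let learnt w := alg (neg_sample (Z ^~ w) 0 (sigma w)) (pos_sample (Z ^~ w) nm np).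

Hypothesis learnt_cont : {ae P, forall w, continuous_score F (learnt w)}.

Let nth_sample w i : (i < N)%N -> nth point (sample w) i = Z i w.
Proof. by move=> iN; rewrite -(tnth_nth point (sample w) (Ordinal iN)) tnth_mktuple. Qed.

Let score_learnt w : score (sigma w) (sample w) = learnt w.
Proof.
rewrite /score /learnt; congr (alg _ _); apply: eq_from_tnth => i; rewrite !tnth_mktuple.
  by rewrite !nth_sample//; apply: leq_trans (ltn_ord _) _; rewrite -addnA leq_addr.
by rewrite nth_sample// -addnA ltn_add2l; apply: leq_trans (ltn_ord _) _; rewrite leq_addr.
Qed.

Let measurable_score s : measurable_fun [set: N.-tuple T * T] (fun zb => score s zb.1 zb.2).
Proof.
have mnth i : measurable_fun setT (fun zb : N.-tuple T * T => nth point zb.1 i).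
  exact: (@measurableT_comp _ _ _ _ _ _ (fun z : N.-tuple T => nth point z i) setT fst
    (@measurable_nth_tuple _ _ _ _) measurable_fst).
apply: (@measurableT_comp _ _ _ _ _ _ _ setT (fun zb : N.-tuple T * T =>
  (neg_sample (nth point zb.1) 0 s, pos_sample (nth point zb.1) nm np, zb.2)) malg).
apply: measurable_fun_pair ; last exact: measurable_snd.
apply: measurable_fun_pair; apply: measurable_fun_mktuple => i //.
apply: measurable_fun_pair.
  exact: (@measurableT_comp _ _ _ _ _ _ fst setT _ measurable_fst (mnth _)).
exact: (@measurableT_comp _ _ _ _ _ _ snd setT _ measurable_snd (mnth _)).
Qed.

Let score_dep s z z' :
  (forall i : 'I_n, tnth z (lshift (m + k) i) = tnth z' (lshift (m + k) i)) ->
  score s z = score s z'.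
Proof.
move=> zz'; have nthE i : (i < n)%N -> nth point z i = nth point z' i.
  by move=> ni; have := zz' (Ordinal ni); rewrite !(tnth_nth point).
rewrite /score; congr (alg _ _); apply: eq_from_tnth => i; rewrite !tnth_mktuple.
  by rewrite !nthE//; apply: leq_trans (ltn_ord _) _; rewrite leq_addr.
by rewrite nthE// ltn_add2l.
Qed.

Let sigma_gt0 s : (0 < P (sigma @^-1` [set s]))%E.
Proof.
rewrite -[P _]/(distribution P sigma [set s]) sigmaU uniform_on1 lte_fin invr_gt0 ltr0n.
by apply/card_gt0P; exists s.
Qed.

(** Continuity is known almost surely on [Omega]. The event that [sigma] equals [s] has positive
    probability and is independent of the sample, so a bad set [D] of positive measure would yield a
    non-null exceptional event. *)
Let score_cont s D : measurable D ->
  (forall z, D z -> ~ continuous_score F (score s z)) -> mu D = 0%E.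
Proof.
move=> mD Dbad; have := @sample_indep D [set s] setT mD.
rewrite preimage_setT setIT probability_setT mule1.
have /negligibleP -> : P.-negligible (sample @^-1` D `&` sigma @^-1` [set s]).
  - apply: negligibleS learnt_cont => w [/= Dw sw] /= cw.
    by apply: (Dbad _ Dw); rewrite -sw score_learnt.
  - by move=> /esym/eqP; rewrite mule_eq0 (gt_eqF (sigma_gt0 s)) orbF => /eqP.
by apply: measurableI; exact: measurable_funPTI.
Qed.

(** Only the negative block of the second part is moved. In [twist] it acts on second components
    alone, as [sigma'] does in the test. *)
Let blocks (t : {perm 'I_m}) : {perm 'I_N} := block_perm 1%g (block_perm t 1%g).

Let twist t (z : N.-tuple T) : N.-tuple T :=
  [tuple ((tnth z ((1%g : {perm 'I_N}) i)).1, (tnth z (blocks t i)).2) | i < N].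

Let event s t := twist t @^-1` [set z | score_test phi alpha (score s) z 1%g = 1%N].

Let mevent0 s : measurable [set z | score_test phi alpha (score s) z 1%g = 1%N].
Proof. exact: measurable_score_test. Qed.

Let mtwist t : measurable_fun setT (twist t).
Proof.
apply: measurable_fun_mktuple => i; apply: measurable_fun_pair.
  exact: measurableT_comp (measurable_tnth _).
exact: measurableT_comp (measurable_tnth _).
Qed.

(** Under the null hypothesis the twist preserves the law of the sample, which leaves the level of
    the untwisted test for a frozen score. *)
Let mu_event s t : (mu (event s t) <= alpha%:E)%E.
Proof.
rewrite (twist_invariant sample_box 1%g (blocks t) FHG (mevent0 s)).
apply: (score_test_level phi sample_box FHG alpha01 (measurable_score s)).
- exact: score_dep.
- exact: score_cont.
Qed.

Let mevent s t : measurable (event s t).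
Proof. by rewrite -[X in measurable X]setTI; exact: mtwist. Qed.

Let eventE w : event (sigma w) (sigma' w) (sample w) <->
  rank_test phi alpha
    (map_tuple (learnt w) (neg_sample (Z ^~ w) n (sigma' w)))
    (map_tuple (learnt w) (pos_sample (Z ^~ w) (n + m) k)) = 1%N.
Proof.
rewrite /event/= /score_test.
rewrite (_ : score _ (twist _ _) = learnt w); last first.
  (* The twist fixes the first part, hence the learnt score. *)
  rewrite -score_learnt; apply: score_dep => i.
  by rewrite tnth_mktuple perm1 /blocks block_perml perm1 -surjective_pairing.
set neg := [tuple _ | _ < m]; set pos := [tuple _ | _ < k].
have -> : neg = map_tuple (learnt w) (neg_sample (Z ^~ w) n (sigma' w)).
  apply: eq_from_tnth => i; rewrite [RHS]tnth_map !tnth_mktuple !perm1.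
  by rewrite /blocks block_permr block_perml.
have -> // : pos = map_tuple (learnt w) (pos_sample (Z ^~ w) (n + m) k).
apply: eq_from_tnth => i; rewrite [RHS]tnth_map !tnth_mktuple !perm1.
rewrite /blocks !block_permr perm1 -surjective_pairing /=.
by rewrite addnA.
Qed.

(** The rejection event is split according to the finitely many values of both permutations, each
    piece being controlled by independence and [mu_event]. *)
Lemma split_sample_test_level :
  (P [set w | rank_test phi alpha
    (map_tuple (learnt w) (neg_sample (Z ^~ w) n (sigma' w)))
    (map_tuple (learnt w) (pos_sample (Z ^~ w) (n + m) k)) = 1%N] <= alpha%:E)%E.
Proof.
pose C (st : {perm 'I_nm} * {perm 'I_m}) :=
  sample @^-1` event st.1 st.2 `&` (sigma @^-1` [set st.1] `&` sigma' @^-1` [set st.2]).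
have -> : [set w | rank_test phi alpha
    (map_tuple (learnt w) (neg_sample (Z ^~ w) n (sigma' w)))
    (map_tuple (learnt w) (pos_sample (Z ^~ w) (n + m) k)) = 1%N] =
    \bigcup_(st in [set: _]) C st.
  apply/seteqP; split=> w.
    by move=> /eventE ?; exists (sigma w, sigma' w).
  move=> [[s t] _ [/= Est [/= ss tt]]]; apply/eventE.
  by rewrite ss tt.
apply: le_trans (measure_bigsetU_le _ _) _.
  move=> st; apply: measurableI; first exact: measurable_funPTI.
  by apply: measurableI; exact: measurable_funPTI.
have PC st : (P (C st) <= (alpha * (#|{perm 'I_nm}|%:R^-1 * #|{perm 'I_m}|%:R^-1))%:E)%E.
  rewrite sample_indep// EFinM lee_pmul//; first by rewrite mule_ge0.
  rewrite -[P (sigma @^-1` _)]/(distribution P sigma _) sigmaU.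
  by rewrite -[P (sigma' @^-1` _)]/(distribution P sigma' _) sigmaU' !uniform_on1.
(* The uniform weights of all pairs of permutations add up to 1, leaving [alpha]. *)
apply: le_trans (lee_sum _ (fun st _ => PC st)) _.
rewrite sumEFin lee_fin sumr_const card_prod -[leLHS]mulr_natr natrM -mulrA -invfM mulVf ?mulr1//.
by rewrite -natrM pnatr_eq0 -lt0n muln_gt0; apply/andP; split; apply/card_gt0P; exists 1%g.
Qed.

End split_sample.

Theorem proposition2 (R : realType) (d dX dY : measure_display)
    (Omega : measurableType d) (TX : measurableType dX) (TY : measurableType dY)
    (P : probability Omega R)
    (F : probability (TX * TY)%type R)
    (H : probability TX R) (G : probability TY R)
    (N n : nat) (p : R)
    (Z : nat -> {RV P >-> (TX * TY)%type})
    (sigma : {RV P >-> {perm 'I_(nminus p n)}})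
    (sigma' : {RV P >-> {perm 'I_(nminus p (N - n))}})
    (A : forall m k, m.-tuple (TX * TY) -> k.-tuple (TX * TY) ->
           TX * TY -> \bar R)
    (phi : R -> R) (alpha : R) :
  let n' := (N - n)%N in
  let nm := nminus p n in
  let np := nplus p n in
  let nm' := nminus p n' in
  let np' := nplus p n' in
  let z w i := Z i w in
  let shat w :=
    A nm np (neg_sample (z w) 0 (sigma w)) (pos_sample (z w) nm np) in
  let Dm' w := neg_sample (z w) n (sigma' w) in
  let Dp' w := pos_sample (z w) (n + nm') np' in
  let Phi w := rank_test phi alpha
    (map_tuple (shat w) (Dm' w)) (map_tuple (shat w) (Dp' w)) in
  (* H and G are the marginals of F *)
  (forall B, measurable B -> H B = F (B `*` [set: TY])) ->
  (forall B, measurable B -> G B = F ([set: TX] `*` B)) ->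
  (* sample sizes *)
  ~~ odd n -> (n < N)%N -> 0 < p < 1 ->
  (1 <= nm' < n')%N -> (1 <= np' < n')%N ->
  (* sampling scheme *)
  (forall i, (i < N)%N ->
    forall B, measurable B -> distribution P (Z i) B = F B) ->
  (forall B, distribution P sigma B = uniform_on R [set: {perm 'I_nm}]%SET B) ->
  (forall B, distribution P sigma' B = uniform_on R [set: {perm 'I_nm'}]%SET B) ->
  mutually_independent P (@sources _ _ _ _ N _ _ Z sigma sigma') ->
  bipartite_ranking_algorithm A ->
  {in `[0, 1] &, {homo phi : x y / x < y}} ->
  0 < alpha < 1 ->
  (* no ties: the law of the scores is continuous *)
  {ae P, forall w, continuous_score F (shat w)} ->
  (* null hypothesis *)
  (forall B, measurable B -> F B = (H \x G)%E B) ->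
  (P [set w | Phi w = 1%N] <= alpha%:E)%E.
Proof.
move=> n' nm np nm' np' z shat Dm' Dp' Phi _ _ _ nN p01 _ _.
move=> ZF sigmaU sigmaU' indep algA _ alpha01 shat_cont FHG.
(* Subtraction on naturals is truncated, so the block sizes add up only because [nplus p n] is at
   most [n]. *)
have En : (nm + np)%N = n by rewrite /nm /nminus subnK// nplus_le.
have EN : (nm + np + (nm' + np'))%N = N.
  by rewrite En /nm' /nminus subnK ?nplus_le// subnKC// ltnW.
have FHGX (C : set TX) (D : set TY) : measurable C -> measurable D ->
    F (C `*` D) = (H C * G D)%E.
  by move=> mC mD; rewrite FHG ?product_measure1E//; exact: measurableX.
have := @split_sample_test_level _ _ _ _ _ _ _ P F H G nm np nm' np' Z sigma sigma'
  (@A nm np) phi alpha FHGX.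
rewrite EN => /(_ ZF sigmaU sigmaU' indep (algA nm np).2 alpha01 shat_cont).
rewrite En; congr (P _ <= _)%E; apply/seteqP; split=> w //.
Qed.
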